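(* Let $V$ be a finite vocabulary with $|V|=L$, let $\rho:V\times V\to[0,1]$ be a symmetric rating function (i.e. $\rho(v,w)=\rho(w,v)$ for all $v,w\in V$) with sensitivity $\Delta>0$ (all words being considered adjacent), let $\epsilon>0$ be a privacy parameter, and let $n\in\mathbb{N}$, $n\ge1$, be an output length. Then the SynTF mechanism with parameters $V,\rho,\epsilon,n$ fulfills $\big((\epsilon+\ln\eta(\epsilon,L))\cdot n\big)$-differential privacy, where any two input documents are considered adjacent and $$\eta(\epsilon,L)=\frac{e^{-\epsilon/2}+L-1}{e^{\epsilon/2}+L-1}.$$
   Context: **Randomized mechanism.** A randomized mechanism $\mathcal{M}$ from $\mathcal{X}$ to $\mathcal{Z}$ assigns to each input $x\in\mathcal{X}$ a random variable $\mathcal{M}(x)$ with values in $\mathcal{Z}$. **Differential privacy.** Given a symmetric adjacency relation on $\mathcal{X}$, the mechanism $\mathcal{M}$ fulfills $\epsilon$-differential privacy if $\Pr[\mathcal{M}(x_1)\in Z]\le e^{\epsilon}\Pr[\mathcal{M}(x_2)\in Z]$ for all adjacent $x_1,x_2\in\mathcal{X}$ and every set $Z$ of possible outputs. **Sensitivity.** Since all words of $V$ are considered adjacent, the sensitivity of $\rho$ is $\Delta=\max_{w\in V}\max_{v_1,v_2\in V}\big(\rho(v_1,w)-\rho(v_2,w)\big)$. **Exponential mechanism on $V$.** For $v\in V$, $\mathcal{E}_{\epsilon,\rho}(v)$ is the $V$-valued random variable with $$\Pr[\mathcal{E}_{\epsilon,\rho}(v)=w]=\frac{\exp\left(\frac{\epsilon}{2\Delta}\rho(v,w)\right)}{\sum_{w'\in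 V}\exp\left(\frac{\epsilon}{2\Delta}\rho(v,w')\right)}.$$ **SynTF mechanism.** The input is a document given by its composition vector $\theta=(\theta_v)_{v\in V}$, a probability vector on $V$ (obtained as $\theta=\mathbf{t}/\|\mathbf{t}\|_1$ from a nonzero vector $\mathbf{t}\in\mathbb{R}_{\ge0}^{V}$ of term frequencies or tf-idf values). For $i=1,\dots,n$, independently: sample $v_i\in V$ with $\Pr[v_i=v]=\theta_v$, then sample $w_i$ from $\mathcal{E}_{\epsilon,\rho}(v_i)$. The output is the count vector $\mathbf{s}=\big(|\{i\in\{1,\dots,n\}:w_i=w\}|\big)_{w\in V}\in\mathbb{N}_{\geq 0}^{V}$. The length $n$ is a fixed parameter, the same for all inputs. Any two inputs are considered adjacent. *)

(* Defs.v *)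
From HB Require Import structures.
From mathcomp Require Import all_boot all_order all_algebra.
From mathcomp Require Import all_classical all_reals all_analysis.

Set Implicit Arguments.
Unset Strict Implicit.
Unset Printing Implicit Defensive.

Import Order.TTheory GRing.Theory Num.Theory.

Local Open Scope classical_set_scope.
Local Open Scope ring_scope.

(* Probability vectors on a finite type: they serve as the composition vectors
   of documents and as the distributions of the finite sampling steps. *)
Record fdist (R : realType) (T : finType) := FDist {
  fdist_pmf :> T -> R ;
  fdist_ge0 : forall t, 0 <= fdist_pmf t ;
  fdist_sum1 : \sum_t fdist_pmf t = 1 }.

Section sampling.
Context {R : realType}.

(* Joint distribution of (s, t), where s is sampled from d and then t from
   K s. *)
Section joint.
Variables (S T : finType) (d : fdist R S) (K : S -> fdist R T).

Definition joint_pmf (u : S * T) : R := d u.1 * K u.1 u.2.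

Lemma joint_pmf_ge0 u : 0 <= joint_pmf u.
Proof. by rewrite mulr_ge0 ?fdist_ge0. Qed.

Lemma joint_pmf_sum1 : \sum_u joint_pmf u = 1.
Proof.
rewrite -(pair_bigA _ (fun s t => d s * K s t)) /= -(fdist_sum1 d).
by apply: eq_bigr => s _; rewrite -mulr_sumr fdist_sum1 mulr1.
Qed.

Definition fdist_joint : fdist R (S * T)%type := FDist joint_pmf_ge0 joint_pmf_sum1.
End joint.

Section iid.
Variables (T : finType) (n : nat) (d : fdist R T).

Definition iid_pmf (f : {ffun 'I_n -> T}) : R := \prod_i d (f i).

Lemma iid_pmf_ge0 f : 0 <= iid_pmf f.
Proof. by apply: prodr_ge0 => i _; exact: fdist_ge0. Qed.

Lemma iid_pmf_sum1 : \sum_f iid_pmf f = 1.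
Proof.
rewrite -(bigA_distr_bigA (fun (_ : 'I_n) t => d t)) /=.
by rewrite big1 // => i _; exact: fdist_sum1.
Qed.

Definition fdist_iid : fdist R {ffun 'I_n -> T} := FDist iid_pmf_ge0 iid_pmf_sum1.
End iid.

End sampling.

(* law p X A is Pr[X in A] for a random variable X on the finite probability
   space (S, p) with values in an arbitrary measurable space. *)
Section law.
Context {R : realType} {S : finType} {d : measure_display}
  {Z : measurableType d}.
Variables (p : fdist R S) (X : S -> Z).

Definition law (A : set Z) : \bar R := (\sum_(s | X s \in A) p s)%:E.

Lemma lawE A : law A = (\sum_s (p s)%:E * \d_(X s) A)%E.
Proof.
rewrite /law -sumEFin big_mkcond; apply: eq_bigr => s _.
by rewrite diracE; case: ifP; rewrite ?mule1 ?mule0.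
Qed.

Let law0 : law set0 = 0%E.
Proof. by rewrite lawE big1 // => s _; rewrite measure0 mule0. Qed.

Let law_ge0 A : (0 <= law A)%E.
Proof. by rewrite lee_fin sumr_ge0 // => s _; exact: fdist_ge0. Qed.

Let law_sigma_additive : semi_sigma_additive law.
Proof.
move=> F mF tF mUF.
rewrite lawE (_ : (fun n => _) =
    fun n => (\sum_s (p s)%:E * \sum_(0 <= i < n) \d_(X s) (F i))%E); last first.
  apply/funext => n; under eq_bigr do rewrite lawE.
  rewrite exchange_big /=; apply: eq_bigr => s _.
  by rewrite ge0_sume_distrr.
apply: cvg_nnesum => s _.
- by apply: nearW => n; rewrite mule_ge0 ?lee_fin ?fdist_ge0 ?sume_ge0.
- by apply: cvgeZl => //; exact: measure_semi_sigma_additive.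
Qed.

HB.instance Definition _ := isMeasure.Build _ _ _ law
  law0 law_ge0 law_sigma_additive.

Let law_setT : law [set: Z] = 1%E.
Proof.
by rewrite /law -(fdist_sum1 p); congr EFin; apply: eq_bigl => s; rewrite in_setT.
Qed.

HB.instance Definition _ := Measure_isProbability.Build _ _ _ law law_setT.
End law.

(* A mechanism is given by the law of its output on each input, which is all
   that differential privacy depends on. *)
Definition mechanism (R : realType) (X : Type) (d : measure_display)
    (Z : measurableType d) : Type :=
  X -> probability Z R.

Definition differentially_private (R : realType) (X : Type)
    (d : measure_display) (Z : measurableType d) (adj : X -> X -> Prop)
    (eps : R) (M : mechanism R X Z) : Prop :=
  forall x1 x2 : X, adj x1 x2 ->
  forall A : set Z, measurable A -> (M x1 A <= (expR eps)%:E * M x2 A)%E.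

(* Count vectors; every set of count vectors is measurable. *)
Definition count_vector (V : finType) : Type := {ffun V -> nat}.

HB.instance Definition _ (V : finType) := Choice.on (count_vector V).
HB.instance Definition _ (V : finType) :=
  isPointed.Build (count_vector V) [ffun => 0%N].
HB.instance Definition _ (V : finType) :=
  @isMeasurable.Build default_measure_display (count_vector V)
    discrete_measurable discrete_measurable0
    discrete_measurableC discrete_measurableU.

Section SynTF.
Context {R : realType} {V : finType}.
Variable rho : V -> V -> R.

(* The differences include 0 (take v1 = v2), so starting the maxima from 0
   does not change their value when V is nonempty. *)
Definition sensitivity : R :=
  \big[Num.max/0]_(w : V) \big[Num.max/0]_(v1 : V) \big[Num.max/0]_(v2 : V)
    (rho v1 w - rho v2 w).

Section exponential_mechanism.
Variables (eps : R) (v : V).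

Definition exp_weight (w : V) : R :=
  expR (eps / (2 * sensitivity) * rho v w).

Definition exp_pmf (w : V) : R := exp_weight w / \sum_w' exp_weight w'.

Lemma exp_weight_sum_gt0 : 0 < \sum_w exp_weight w.
Proof.
rewrite (bigD1 v) //= ltr_wpDr ?expR_gt0 //.
by rewrite sumr_ge0 // => w _; exact: expR_ge0.
Qed.

Lemma exp_pmf_ge0 w : 0 <= exp_pmf w.
Proof. by rewrite divr_ge0 ?expR_ge0 // ltW // exp_weight_sum_gt0. Qed.

Lemma exp_pmf_sum1 : \sum_w exp_pmf w = 1.
Proof. by rewrite -mulr_suml divff // gt_eqF // exp_weight_sum_gt0. Qed.

Definition exp_mechanism : fdist R V := FDist exp_pmf_ge0 exp_pmf_sum1.
End exponential_mechanism.

(* f i is the pair (v_i, w_i). *)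
Definition synTF_counts (n : nat) (f : {ffun 'I_n -> V * V}) : count_vector V :=
  [ffun w => #|[pred i | (f i).2 == w]|].

Definition synTF (eps : R) (n : nat) :
    mechanism R (fdist R V) (count_vector V) :=
  fun theta =>
    law (fdist_iid n (fdist_joint theta (exp_mechanism eps))) (@synTF_counts n).
End SynTF.

Definition eta {R : realType} (eps : R) (L : nat) : R :=
  (expR (- eps / 2) + L%:R - 1) / (expR (eps / 2) + L%:R - 1).

(* Main.v *)
(* Write A = e^(eps/2) and m = L - 1. For words v1, v2, w put
   y = exp_weight v1 w and x = exp_weight v2 w, and let S1, S2 be the sums of
   the weights of v1, v2 over the words other than w. The sensitivity bounds
   give y <= A x and S2 <= A S1; symmetry of rho lets the sensitivity bound the
   variation of rho v2 in its second argument too, whence S2 <= m A x. These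
   three inequalities imply
   y / (y + S1) <= A^2 (A^-1 + m) / (A + m) * x / (x + S2).
   The bound passes to mixtures over the composition vector, then to products
   over the n independent samples, and finally to sums over any event. *)
Require Import Defs.
From mathcomp Require Import all_boot all_order all_algebra.
From mathcomp Require Import all_classical all_reals all_analysis.
From mathcomp Require Import ring lra.

Import Order.TTheory GRing.Theory Num.Theory.

Local Open Scope ring_scope.

Section sampling.
Context {R : realType} {S T : finType}.

Definition fdist_mixture (d : fdist R S) (K : S -> fdist R T) (t : T) : R :=
  \sum_s d s * K s t.

Lemma fdist_mixture_ge0 (d : fdist R S) (K : S -> fdist R T) t :
  0 <= fdist_mixture d K t.
Proof. by apply: sumr_ge0 => s _; rewrite mulr_ge0 ?fdist_ge0. Qed.

Lemma fdist_joint_snd (d : fdist R S) (K : S -> fdist R T) t :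
  \sum_(u : S * T | u.2 == t) fdist_joint d K u = fdist_mixture d K t.
Proof.
rewrite -(pair_big xpredT (pred1 t) (fun s t' => d s * K s t')) /=.
by apply: eq_bigr => s _; rewrite big_pred1_eq.
Qed.

(** Inserting the unit masses of [d1] and [d2] turns both sides into averages over the same pairs
    [(s1, s2)], so no relation between [d1] and [d2] is needed. *)
Lemma fdist_mixture_le (d1 d2 : fdist R S) (K : S -> fdist R T) (c : R) t :
    (forall s1 s2, K s1 t <= c * K s2 t) ->
  fdist_mixture d1 K t <= c * fdist_mixture d2 K t.
Proof.
move=> leK; rewrite -[leLHS]mul1r -(fdist_sum1 d2) mulr_suml mulr_sumr.
apply: ler_sum => s2 _; rewrite mulrCA ler_wpM2l ?fdist_ge0 //.
rewrite -[leRHS]mul1r -(fdist_sum1 d1) mulr_suml.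
by apply: ler_sum => s1 _; rewrite ler_wpM2l ?fdist_ge0.
Qed.

(** The samples [(f i).1] are marginalised out: the fibre of the second projection over [g] is a
    product set, so the sum over it factors coordinatewise. *)
Lemma sum_iid_joint_snd (d : fdist R S) (K : S -> fdist R T) n
    (P : pred {ffun 'I_n -> T}) :
  \sum_(f : {ffun 'I_n -> S * T} | P [ffun i => (f i).2])
     fdist_iid n (fdist_joint d K) f
  = \sum_(g | P g) \prod_i fdist_mixture d K (g i).
Proof.
rewrite (partition_big (fun f : {ffun 'I_n -> S * T} => [ffun i => (f i).2]) P) //=.
apply: eq_bigr => g Pg.
under [RHS]eq_bigr do rewrite -fdist_joint_snd.
rewrite bigA_distr_big_dep /=; apply: eq_bigl => f.
apply/andP/familyP => [[_ /eqP <-] i|fg]; first by rewrite unfold_in /= ffunE.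
suff -> : [ffun i => (f i).2] = g by [].
by apply/ffunP => i; rewrite ffunE; apply/eqP; exact: fg.
Qed.

End sampling.

Lemma ratio_bound (R : realFieldType) (A m x y S1 S2 : R) :
    1 <= A -> 0 <= m -> 0 <= x -> 0 <= y ->
    0 <= S2 -> y <= A * x -> S2 <= A * S1 -> S2 <= m * A * x ->
  y * (x + S2) * (A + m) <= A ^+ 2 * (A^-1 + m) * x * (y + S1).
Proof.
move=> A1 m0 x0 y0 S20 yx S21 S2x.
have A0 : 0 < A by lra.
rewrite -(ler_pM2l A0) -subr_ge0.
(* The factor [A] clears [A^-1]; the difference is then a nonnegative combination of the slacks of
   the three hypotheses, with [1 <= A] giving the sign of the last coefficient. *)
have -> : A * (A ^+ 2 * (A^-1 + m) * x * (y + S1)) - A * (y * (x + S2) * (A + m))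
   = A * (1 + A * m) * x * (A * S1 - S2) + (1 + A * m) * S2 * (A * x - y)
     + (A ^+ 2 - 1) * y * (m * A * x - S2).
  by field; rewrite gt_eqF.
have Am : 0 <= 1 + A * m by rewrite addr_ge0 // mulr_ge0 // ltW.
by rewrite !addr_ge0 // !mulr_ge0 ?subr_ge0 ?exprn_ege1 // ltW.
Qed.

Section exponential_mechanism.
Context {R : realType} {V : finType}.
Variables (rho : V -> V -> R) (eps : R).
Hypothesis sensitivity_gt0 : 0 < sensitivity rho.
Hypothesis eps_gt0 : 0 < eps.

Lemma rho_sub_le_sensitivity v1 v2 w : rho v1 w - rho v2 w <= sensitivity rho.
Proof.
rewrite /sensitivity; apply: le_trans (le_bigmax _ _ w).
apply: le_trans (le_bigmax _ _ v1).
exact: (le_bigmax _ (fun v => rho v1 w - rho v w) v2).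
Qed.

(** All four words are free, so that this covers a change of input word and a change of output
    word. *)
Lemma exp_weight_le v1 w1 v2 w2 :
    rho v1 w1 - rho v2 w2 <= sensitivity rho ->
  exp_weight rho eps v1 w1 <= expR (eps / 2) * exp_weight rho eps v2 w2.
Proof.
move=> le_rho; rewrite /exp_weight -expRD ler_expR -lerBlDr -mulrBr.
have -> : eps / 2 = eps / (2 * sensitivity rho) * sensitivity rho.
  by field; rewrite gt_eqF.
by rewrite ler_wpM2l // divr_ge0 ?mulr_ge0 // ltW.
Qed.

Hypothesis rho_sym : forall v w, rho v w = rho w v.

Lemma eta_gt0 (v : V) : 0 < eta eps #|V|.
Proof.
have V1 : 1 <= #|V|%:R :> R by rewrite ler1n; apply/card_gt0P; exists v.
by rewrite /eta divr_gt0 // -addrA ltr_wpDr ?expR_gt0 // subr_ge0.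
Qed.

Lemma exp_mechanism_ratio v1 v2 w :
  exp_mechanism rho eps v1 w
    <= expR eps * eta eps #|V| * exp_mechanism rho eps v2 w.
Proof.
pose e := exp_weight rho eps.
have V1 : 1 <= #|V|%:R :> R by rewrite ler1n; apply/card_gt0P; exists w.
have e0 v w' : 0 <= e v w' by exact: expR_ge0.
set m : R := #|V|%:R - 1; set A := expR (eps / 2).
have m0 : 0 <= m by rewrite subr_ge0.
have A0 : 0 < A by exact: expR_gt0.
(* One unit per word other than [w], for a termwise comparison below. *)
have mE : m = \sum_(w' | w' != w) 1.
  by rewrite /m -sum1_card natr_sum (bigD1 w) //= addrAC subrr add0r.
have := @ratio_bound _ A m (e v2 w) (e v1 w)
  (\sum_(w' | w' != w) e v1 w') (\sum_(w' | w' != w) e v2 w').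
have -> : e v1 w + \sum_(w' | w' != w) e v1 w' = \sum_w' e v1 w'.
  by rewrite [RHS](bigD1 w).
have -> : e v2 w + \sum_(w' | w' != w) e v2 w' = \sum_w' e v2 w'.
  by rewrite [RHS](bigD1 w).
move=> bound.
have -> : expR eps * eta eps #|V| * exp_mechanism rho eps v2 w
    = A ^+ 2 * (A^-1 + m) * e v2 w / ((\sum_w' e v2 w') * (A + m)).
  rewrite /= /exp_pmf /eta mulNr expRN -!addrA -/m -/A -/e invfM.
  by rewrite (_ : expR eps = A ^+ 2) ?expr2 -?expRD -?splitr //; ring.
rewrite /= /exp_pmf -/e ler_pdivrMr ?exp_weight_sum_gt0 // mulrAC.
rewrite ler_pdivlMr ?mulr_gt0 ?exp_weight_sum_gt0 ?ltr_wpDr //.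
rewrite mulrA; apply: bound => //.
- by rewrite -expR0 ler_expR divr_ge0 // ltW.
- exact: sumr_ge0.
- exact/exp_weight_le/rho_sub_le_sensitivity.
- rewrite mulr_sumr; apply: ler_sum => w' _.
  exact/exp_weight_le/rho_sub_le_sensitivity.
(* Here the output word varies; symmetry makes it the input word. *)
- rewrite mE -mulrA mulr_suml; apply: ler_sum => w' _; rewrite mul1r.
  by apply: exp_weight_le; rewrite !(rho_sym v2) rho_sub_le_sensitivity.
Qed.

End exponential_mechanism.

Theorem corollary3p5 (R : realType) (V : finType) (L : nat)
    (rho : V -> V -> R) (eps : R) (n : nat)
    (card_V : #|V| = L)
    (rho_range : forall v w : V, 0 <= rho v w <= 1)
    (rho_sym : forall v w : V, rho v w = rho w v)
    (sensitivity_gt0 : 0 < sensitivity rho)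
    (eps_gt0 : 0 < eps)
    (n_ge1 : (1 <= n)%N) :
  differentially_private (fun _ _ : fdist R V => True)
    ((eps + ln (eta eps L)) * n%:R) (synTF rho eps n).
Proof.
move=> theta1 theta2 _ A _; rewrite -EFinM lee_fin -card_V.
pose out (g : {ffun 'I_n -> V}) : count_vector V :=
  [ffun w => #|[pred i | g i == w]|].
have outE (f : {ffun 'I_n -> V * V}) :
    synTF_counts f = out [ffun i => (f i).2].
  by apply/ffunP => w; rewrite !ffunE; apply: eq_card => i; rewrite !inE ffunE.
have sumE theta :
    \sum_(f | synTF_counts f \in A)
       fdist_iid n (fdist_joint theta (exp_mechanism rho eps)) f
    = \sum_(g | out g \in A)
        \prod_i fdist_mixture theta (exp_mechanism rho eps) (g i).
  rewrite -(sum_iid_joint_snd _ _ _ (fun g => out g \in A)).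
  by apply: eq_bigl => f; rewrite outE.
rewrite !sumE mulr_sumr; apply: ler_sum => g _.
(* A word is needed for [eta] to be positive; as [n >= 1], [g] takes a value in [V]. *)
have [v _|V0] := pickP (mem V); last first.
  by case: n n_ge1 g {out outE sumE} => // n _ g; have := V0 (g ord0).
(* The privacy factor becomes an [n]-th power, one factor per sample. *)
rewrite expRM_natr expRD lnK ?posrE ?(eta_gt0 _ v) //.
rewrite -[n in _ ^+ n]card_ord -prodr_const -big_split /=.
apply: ler_prod => i _; rewrite fdist_mixture_ge0 /=.
by apply: fdist_mixture_le => v1 v2; exact: exp_mechanism_ratio.
Qed.
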